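(* Let $A$ be a unital Banach algebra, let $a\in A$ and let $k$ be a non-negative integer. Then the following statements are equivalent. (i) The element $a\in A$ is Drazin invertible and $\mathrm{index}(a)=k$. (ii) $L_a\in L(A)$ is Drazin invertible and $\mathrm{index}(L_a)=k$. (iii) $R_a\in L(A)$ is Drazin invertible and $\mathrm{index}(R_a)=k$. Moreover, in this case, if $b$ is the Drazin inverse of $a$, then $L_b$ (respectively $R_b$) is the Drazin inverse of $L_a$ (respectively $R_a$). As a consequence, for every $a\in A$, (iv) $\sigma_{\mathcal{DR}}(a)=\sigma_{\mathcal{DR}}(L_a)=\sigma_{\mathcal{DR}}(R_a)$.
   Context: Banach algebras and Banach spaces are complex. For a Banach space $Y$, $L(Y)$ is the unital Banach algebra of all bounded linear operators on $Y$. For a unital Banach algebra $A$ with unit $e$ and $a\in A$, the operators $L_a,R_a\in L(A)$ are defined by $L_a(x)=ax$ and $R_a(x)=xa$ for $x\in A$. An element $a$ of a unital Banach algebra $B$ is called Drazin invertible if there exist a (necessarily unique) $b\in B$ and some non-negative integer $m$ such that $a^mba=a^m$, $bab=b$, $ab=ba$ (with $a^0=e$). The element $b$ is the Drazin inverse of $a$, and $\mathrm{index}(a)$ is the least non-negative integer $m$ for which these equations hold. Drazin invertibility and index of $L_a$, $R_a$ are understood in the Banach algebra $L(A)$. The Drazin spectrum of $a\in B$ is $\sigma_{\mathcal{DR}}(a)=\{\lambda\in\mathbb{C}: a-\lambda e \text{ is not Drazin invertible in } B\}$. *)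

(* Defs.v *)
(* The complex numbers are R[i] for R : realType. *)
From HB Require Import structures.
From mathcomp Require Import all_boot all_order all_algebra.
From mathcomp Require Import complex.
From mathcomp Require Import all_classical all_reals all_analysis.

Set Implicit Arguments.
Unset Strict Implicit.
Unset Printing Implicit Defensive.

Import Order.TTheory GRing.Theory Num.Theory.
Import numFieldNormedType.Exports.

Local Open Scope classical_set_scope.
Local Open Scope complex_scope.
Local Open Scope ring_scope.

(* Unital Banach algebras. This is a plain record because HB has no join of
   rings and normed modules below numDomainType and so refuses the structure.
   Neither 1 != 0 nor `|1| = 1 is imposed, so that L(Y) is an instance for every
   Banach space Y, including Y = 0. *)
Record banachAlgType (K : numFieldType) := BanachAlgebra {
  banach_space : completeNormedModType K ;
  banach_mul : banach_space -> banach_space -> banach_space ;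
  banach_one : banach_space ;
  banach_mulA : associative banach_mul ;
  banach_mul1 : left_id banach_one banach_mul ;
  banach_mulr1 : right_id banach_one banach_mul ;
  banach_mulDl : left_distributive banach_mul +%R ;
  banach_mulDr : right_distributive banach_mul +%R ;
  banach_scaleAl : forall (c : K) x y,
    c *: banach_mul x y = banach_mul (c *: x) y ;
  banach_scaleAr : forall (c : K) x y,
    c *: banach_mul x y = banach_mul x (c *: y) ;
  banach_normM : forall x y, `|banach_mul x y| <= `|x| * `|y|
}.

Definition banach_sort (K : numFieldType) (B : banachAlgType K) : Type :=
  banach_space B.
Coercion banach_sort : banachAlgType >-> Sortclass.

HB.instance Definition _ (K : numFieldType) (B : banachAlgType K) :=
  CompleteNormedModule.copy (banach_sort B) (banach_space B).
HB.instance Definition _ (K : numFieldType) (B : banachAlgType K) :=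
  GRing.Zmodule_isPzRing.Build (banach_sort B) (@banach_mulA K B)
    (@banach_mul1 K B) (@banach_mulr1 K B) (@banach_mulDl K B)
    (@banach_mulDr K B).

Lemma banach_scalerAl (K : numFieldType) (B : banachAlgType K) (c : K)
  (x y : B) : c *: (x * y) = (c *: x) * y.
Proof. exact: (banach_scaleAl c x y). Qed.

Lemma banach_scalerAr (K : numFieldType) (B : banachAlgType K) (c : K)
  (x y : B) : c *: (x * y) = x * (c *: y).
Proof. exact: (banach_scaleAr c x y). Qed.

Lemma banach_normrM (K : numFieldType) (B : banachAlgType K) (x y : B) :
  `|x * y| <= `|x| * `|y|.
Proof. exact: (banach_normM x y). Qed.

Section BoundedOperators.
Variables (R : realType) (Y : completeNormedModType R[i]).

Definition bounded_linear : {pred Y -> Y} := fun f =>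
  `[< linear f /\ exists M : R, forall x, `|f x| <= M%:C * `|x| >].

Fact bounded_linear_submod_closed : GRing.submod_closed bounded_linear.
Proof.
split.
  apply/asboolP; split=> [c x y|]; first by rewrite /= scaler0 addr0.
  by exists 0 => x; rewrite normr0 mul0r.
move=> c f g /asboolP[lf [M fM]] /asboolP[lg [N gN]]; apply/asboolP; split.
  move=> d x y; have -> z : (c *: f + g) z = c *: f z + g z by [].
  by rewrite lf lg !scalerDr !scalerA addrACA [c * d]mulrC.
exists (complex.Re `|c| * M + N) => x.
apply: (le_trans (ler_normD _ _)).
rewrite rmorphD rmorphM/= mulrDl -mulrA lerD// normrZ.
have -> : (complex.Re `|c|)%:C = `|c| by rewrite RRe_real ?normr_real.
by rewrite ler_wpM2l.
Qed.
HB.instance Definition _ :=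
  GRing.isSubmodClosed.Build R[i] (Y -> Y) bounded_linear
    bounded_linear_submod_closed.

(* The vector space operations on bounded operators are pointwise, as a
   subspace of Y -> Y. *)
Record bounded_op := BoundedOp {
  bounded_op_fun :> Y -> Y ;
  bounded_op_subproof : bounded_op_fun \in bounded_linear }.

HB.instance Definition _ := [isSub for bounded_op_fun].
HB.instance Definition _ := [Choice of bounded_op by <:].
HB.instance Definition _ := [SubChoice_isSubLmodule of bounded_op by <:].

Lemma bounded_opP (f g : bounded_op) : f =1 g -> f = g.
Proof. by move=> fg; apply: val_inj; apply: funext. Qed.

Lemma bounded_op_linear (f : bounded_op) : linear f.
Proof. by have /asboolP[] := bounded_op_subproof f. Qed.

Lemma bounded_op_bounded (f : bounded_op) :
  exists M : R, 0 <= M /\ forall x, `|f x| <= M%:C * `|x|.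
Proof.
have /asboolP[_ [M fM]] := bounded_op_subproof f.
exists `|M|; split=> // x; apply: (le_trans (fM x)).
by rewrite ler_wpM2r// lecR ler_norm.
Qed.

Lemma bounded_op0 (f : bounded_op) : f 0 = 0.
Proof.
by have := bounded_op_linear f (-1) 0 0; rewrite scaler0 addr0 scaleN1r addNr.
Qed.

Lemma bounded_opDE (f g : bounded_op) x : (f + g) x = f x + g x.
Proof. by []. Qed.

Lemma bounded_opZE c (f : bounded_op) x : (c *: f) x = c *: f x.
Proof. by []. Qed.

Lemma bounded_opBE (f g : bounded_op) x : (f - g) x = f x - g x.
Proof. by []. Qed.

(* The operator norm, the least M >= 0 with `|f x| <= M `|x| for all x. *)
Definition bounded_op_norm (f : bounded_op) : R[i] :=
  (inf [set M : R | 0 <= M /\ forall x, `|f x| <= M%:C * `|x|])%:C.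

Lemma bounded_op_norm_le (f : bounded_op) (M : R) : 0 <= M ->
  (forall x, `|f x| <= M%:C * `|x|) -> bounded_op_norm f <= M%:C.
Proof.
move=> M0 fM; rewrite lecR; apply: ge_inf; last by split.
by exists 0 => N [].
Qed.

Lemma bounded_op_norm_leC (f : bounded_op) (M : R[i]) : 0 <= M ->
  (forall x, `|f x| <= M * `|x|) -> bounded_op_norm f <= M.
Proof.
move=> M0; have <- : (complex.Re M)%:C = M by rewrite RRe_real ?ger0_real.
by apply: bounded_op_norm_le; move: M0; rewrite lecE => /andP[].
Qed.

Lemma bounded_op_norm_ge0 (f : bounded_op) : 0 <= bounded_op_norm f.
Proof.
rewrite lecR; apply: lb_le_inf; last by move=> N [].
by have [M] := bounded_op_bounded f; exists M.
Qed.

Lemma bounded_op_norm_bound (f : bounded_op) x :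
  `|f x| <= bounded_op_norm f * `|x|.
Proof.
have [->|x0] := eqVneq x 0; first by rewrite bounded_op0 !normr0 mulr0.
rewrite -ler_pdivrMr ?normr_gt0//.
have q0 : 0 <= `|f x| / `|x| by rewrite divr_ge0.
have Eq : (complex.Re (`|f x| / `|x|))%:C = `|f x| / `|x|.
  by rewrite RRe_real ?ger0_real.
rewrite -Eq lecR; apply: lb_le_inf.
  by have [M] := bounded_op_bounded f; exists M.
by move=> M [M0 fM]; rewrite -lecR Eq ler_pdivrMr ?normr_gt0.
Qed.

Fact bounded_op_ler_normD f g :
  bounded_op_norm (f + g) <= bounded_op_norm f + bounded_op_norm g.
Proof.
apply: bounded_op_norm_leC => [|x]; first by rewrite addr_ge0 ?bounded_op_norm_ge0.
rewrite bounded_opDE (le_trans (ler_normD _ _))// mulrDl.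
by rewrite lerD ?bounded_op_norm_bound.
Qed.

Fact bounded_op_normrZ (c : R[i]) f :
  bounded_op_norm (c *: f) = `|c| * bounded_op_norm f.
Proof.
apply/le_anti/andP; split.
  apply: bounded_op_norm_leC => [|x]; first by rewrite mulr_ge0 ?bounded_op_norm_ge0.
  by rewrite bounded_opZE normrZ -mulrA ler_wpM2l ?bounded_op_norm_bound.
have [->|c0] := eqVneq c 0; first by rewrite normr0 mul0r bounded_op_norm_ge0.
rewrite -ler_pdivlMl ?normr_gt0//; apply: bounded_op_norm_leC => [|x].
  by rewrite mulr_ge0 ?invr_ge0 ?bounded_op_norm_ge0.
rewrite -mulrA ler_pdivlMl ?normr_gt0// -normrZ -bounded_opZE.
exact: bounded_op_norm_bound.
Qed.

Fact bounded_op_normr0_eq0 f : bounded_op_norm f = 0 -> f = 0.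
Proof.
move=> f0; apply: bounded_opP => x; apply/eqP; rewrite -normr_le0.
by have := bounded_op_norm_bound f x; rewrite f0 mul0r.
Qed.

HB.instance Definition _ := Lmodule_isNormed.Build R[i] bounded_op
  bounded_op_ler_normD bounded_op_normrZ bounded_op_normr0_eq0.

Lemma bounded_op_normE (f : bounded_op) : `|f| = bounded_op_norm f.
Proof. by []. Qed.

Fact bounded_op_complete (F : set_system bounded_op) :
  ProperFilter F -> cauchy F -> cvg F.
Proof.
move=> FF /cauchyP cF.
have ballF (e : R[i]) : 0 < e -> exists f, F [set h : bounded_op | `|f - h| < e].
  by move=> e0; have [f Ff] := cF _ e0; exists f; move: Ff; rewrite -ball_normE.
have ptF x : cvg ((fun f : bounded_op => f x) @ F).
  apply/cauchy_cvgP/cauchyP => e e0.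
  have x1 : 0 < `|x| + 1 by rewrite ltr_wpDl.
  have [f Ff] := ballF (e / (`|x| + 1)) (divr_gt0 e0 x1).
  exists (f x); rewrite -ball_normE.
  change (F [set h : bounded_op | `|f x - h x| < e]).
  apply: filterS Ff => h /= fh; rewrite -bounded_opBE.
  apply: le_lt_trans (bounded_op_norm_bound _ _) _.
  apply: (@le_lt_trans _ _ (`|f - h| * (`|x| + 1))).
    by apply: ler_wpM2l; [exact: bounded_op_norm_ge0|rewrite lerDl ler01].
  by rewrite -ltr_pdivlMr.
pose g x := lim ((fun f : bounded_op => f x) @ F).
have gP x : (fun f : bounded_op => f x) @ F --> g x by exact: ptF.
have gB x y c : (\forall h \near F, `|(h : bounded_op) x - y| <= c) ->
    `|g x - y| <= c.
  move=> Fh; apply/ler_addgt0Pr => e e0.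
  have /cvgrPdist_lt/(_ e e0) Fe := gP x.
  have [h [/= hc he]] := filter_ex (filterI Fh Fe).
  rewrite -(subrKA (h x)) (le_trans (ler_normD _ _))// addrC.
  by rewrite lerD// ltW.
have lg : linear g.
  move=> c x y; apply: cvg_lim; first exact: norm_hausdorff.
  rewrite (_ : (fun f : bounded_op => _) = fun f : bounded_op => c *: f x + f y).
    by apply: cvgD; [apply: cvgZl_tmp; exact: gP|exact: gP].
  by apply: funext => f; rewrite bounded_op_linear.
have gbnd : g \in bounded_linear.
  apply/asboolP; split=> //.
  have [f Ff] := ballF 1 ltr01.
  have [M [M0 fM]] := bounded_op_bounded f.
  exists (1 + M) => x; rewrite rmorphD/= rmorph1 mulrDl mul1r.
  rewrite -[g x](subrK (f x)) (le_trans (ler_normD _ _))// lerD//.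
  apply: gB; apply: filterS Ff => h /= fh.
  rewrite -bounded_opBE (le_trans (bounded_op_norm_bound _ _))//.
  by rewrite -bounded_op_normE distrC ler_piMl// ltW.
apply/cvg_ex; exists (BoundedOp gbnd); apply/cvgrPdist_le => e e0.
have e2 : 0 < e / 2 by rewrite divr_gt0.
have [f Ff] := ballF _ e2.
have gf : bounded_op_norm (BoundedOp gbnd - f) <= e / 2.
  apply: bounded_op_norm_leC => [|x]; first exact: ltW.
  rewrite bounded_opBE; apply: gB; apply: filterS Ff => h /= fh.
  rewrite -bounded_opBE (le_trans (bounded_op_norm_bound _ _))//.
  by rewrite -bounded_op_normE distrC ler_wpM2r// ltW.
apply: filterS Ff => h /= fh.
rewrite -(subrKA f) (le_trans (ler_normD _ _))// [leRHS]splitr lerD//.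
exact: ltW.
Qed.
HB.instance Definition _ := Uniform_isComplete.Build bounded_op
  bounded_op_complete.

Fact bounded_op_comp_subproof (f g : bounded_op) : f \o g \in bounded_linear.
Proof.
apply/asboolP; split=> [c x y|]; first by rewrite /= !bounded_op_linear.
have [M [M0 fM]] := bounded_op_bounded f.
have [N [N0 gN]] := bounded_op_bounded g.
exists (M * N) => x; rewrite rmorphM/= -mulrA (le_trans (fM _))//.
by rewrite ler_wpM2l// lecR.
Qed.
Definition bounded_op_comp (f g : bounded_op) : bounded_op :=
  BoundedOp (bounded_op_comp_subproof f g).

Fact bounded_op_id_subproof : @idfun Y \in bounded_linear.
Proof. by apply/asboolP; split=> //; exists 1 => x; rewrite mul1r. Qed.
Definition bounded_op_id : bounded_op := BoundedOp bounded_op_id_subproof.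

Fact bounded_op_compA : associative bounded_op_comp.
Proof. by move=> f g h; apply: bounded_opP. Qed.

Fact bounded_op_comp1 : left_id bounded_op_id bounded_op_comp.
Proof. by move=> f; apply: bounded_opP. Qed.

Fact bounded_op_compr1 : right_id bounded_op_id bounded_op_comp.
Proof. by move=> f; apply: bounded_opP. Qed.

Fact bounded_op_compDl : left_distributive bounded_op_comp +%R.
Proof. by move=> f g h; apply: bounded_opP. Qed.

Fact bounded_opD (f : bounded_op) x y : f (x + y) = f x + f y.
Proof. by have := bounded_op_linear f 1 x y; rewrite !scale1r. Qed.

Fact bounded_op_compDr : right_distributive bounded_op_comp +%R.
Proof. by move=> f g h; apply: bounded_opP => x; rewrite /= bounded_opD. Qed.

Fact bounded_op_scaleAl c f g :
  c *: bounded_op_comp f g = bounded_op_comp (c *: f) g.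
Proof. by apply: bounded_opP. Qed.

Fact bounded_op_scaleAr c f g :
  c *: bounded_op_comp f g = bounded_op_comp f (c *: g).
Proof.
apply: bounded_opP => x.
have := bounded_op_linear f c (g x) 0; rewrite bounded_op0 !addr0.
exact: esym.
Qed.

Fact bounded_op_normM f g : `|bounded_op_comp f g| <= `|f| * `|g|.
Proof.
rewrite !bounded_op_normE; apply: bounded_op_norm_leC => [|x].
  by rewrite mulr_ge0 ?bounded_op_norm_ge0.
rewrite -mulrA; apply: le_trans (bounded_op_norm_bound f (g x)) _.
by rewrite ler_wpM2l ?bounded_op_norm_ge0 ?bounded_op_norm_bound.
Qed.

(* L(Y): the product is composition, the unit the identity of Y. *)
Definition bounded_op_alg : banachAlgType R[i] :=
  @BanachAlgebra R[i] bounded_op bounded_op_comp bounded_op_id bounded_op_compA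
    bounded_op_comp1 bounded_op_compr1 bounded_op_compDl bounded_op_compDr
    bounded_op_scaleAl bounded_op_scaleAr bounded_op_normM.
End BoundedOperators.

Section MultiplicationOperators.
Variables (R : realType) (A : banachAlgType R[i]).
Implicit Types a x : A.

Fact lmul_subproof a : (fun x => a * x) \in @bounded_linear R A.
Proof.
apply/asboolP; split=> [c x y|].
  by rewrite mulrDr -banach_scalerAr.
exists (complex.Re `|a|) => x; rewrite RRe_real ?normr_real//.
exact: banach_normrM.
Qed.

Fact rmul_subproof a : (fun x => x * a) \in @bounded_linear R A.
Proof.
apply/asboolP; split=> [c x y|].
  by rewrite mulrDl -banach_scalerAl.
exists (complex.Re `|a|) => x; rewrite RRe_real ?normr_real// mulrC.
exact: banach_normrM.
Qed.

Definition lmul a : bounded_op_alg A := BoundedOp (lmul_subproof a).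
Definition rmul a : bounded_op_alg A := BoundedOp (rmul_subproof a).
End MultiplicationOperators.

Section Drazin.
Variables (K : numFieldType) (B : banachAlgType K).
Implicit Types a b : B.

Definition drazin_eqs a b (m : nat) : Prop :=
  [/\ a ^+ m * b * a = a ^+ m, b * a * b = b & a * b = b * a].

Definition drazin_inverse a b : Prop := exists m, drazin_eqs a b m.

Definition drazin_invertible a : Prop := exists b, drazin_inverse a b.

Lemma drazin_inverse_unique a b c :
  drazin_inverse a b -> drazin_inverse a c -> b = c.
Proof.
have aux x m : drazin_eqs a x m ->
    [/\ forall n, (m <= n)%N -> a ^+ n * (x * a) = a ^+ n,
        forall n, x ^+ n.+1 * a ^+ n.+1 = x * a & GRing.comm a x].
  move=> [amx xax ax]; split=> // n.
    by move/subnK<-; rewrite exprD -mulrA [a ^+ m * _]mulrA amx.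
  rewrite -exprMn_comm; last exact: esym.
  by elim: n => // n IHn; rewrite exprS IHn mulrA xax.
move=> [m Hb] [m' Hc].
have [Pb Nb Cb] := aux _ _ Hb; have [Pc Nc Cc] := aux _ _ Hc.
have [_ bab _] := Hb; have [_ cac _] := Hc.
pose n := (m + m')%N.
have mn : (m <= n.+1)%N by rewrite leqW ?leq_addr.
have m'n : (m' <= n.+1)%N by rewrite leqW ?leq_addl.
have pq : b * a = c * a.
  transitivity (b * a * (c * a)); first by rewrite -(Nb n) -mulrA Pc.
  have Ca : GRing.comm (b * a) (a ^+ n.+1).
    by apply: commrX; rewrite /GRing.comm [RHS]mulrA Cb.
  rewrite -(Nc n) -(commrX n.+1 (commr_sym (commrX n.+1 (commr_sym Cc)))).
  by rewrite mulrA Ca Pb.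
by rewrite -bab pq -mulrA Cb pq mulrA -[RHS]cac -!mulrA -Cc.
Qed.

(* 0 when a is not Drazin invertible; by drazin_inverse_unique the minimum runs
   over the exponents of the one Drazin inverse of a. *)
Definition drazin_index a : nat :=
  match pselect (exists m, `[< exists b, drazin_eqs a b m >]) with
  | left exm => ex_minn exm
  | right _ => 0
  end.

Definition drazin_spectrum a : set K :=
  [set l : K | ~ drazin_invertible (a - l *: (1 : B))].
End Drazin.

(* Main.v *)
Require Import Defs.
From HB Require Import structures.
From mathcomp Require Import all_boot all_order all_algebra.
From mathcomp Require Import complex.
From mathcomp Require Import all_classical all_reals all_analysis.

(** The map [lmul] is an injective unital homomorphism from [A] to [L(A)], and
[rmul] an injective unital anti-homomorphism. The Drazin equations are
symmetric under reversing products, since the elements involved commute, so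
both maps preserve and reflect them, exponent by exponent.

What remains is that a Drazin inverse [T] of [lmul a] in [L(A)], which could
be any bounded operator, is itself a left multiplication. The reason is that a
Drazin inverse commutes with everything that commutes with the element it
inverts ([drazin_eqs_bicommutant]). By associativity every [rmul x] commutes
with [lmul a], so it commutes with [T], and
[T x = T (rmul x 1) = rmul x (T 1) = T 1 * x]. Thus [T = lmul (T 1)].
Exchanging left and right gives the same for [rmul a].

Hence [a], [lmul a] and [rmul a] satisfy the Drazin equations for the same
exponents ([drazin_eqs_lmulP], [drazin_eqs_rmulP]). These exponents determine
invertibility and index; as [lmul] and [rmul] send [a - l *: 1] to
[lmul a - l *: 1] and [rmul a - l *: 1], they determine the Drazin spectrum
too. *)

Set Implicit Arguments.
Unset Strict Implicit.
Unset Printing Implicit Defensive.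

Import GRing.Theory.

Local Open Scope complex_scope.
Local Open Scope ring_scope.

Section DrazinGeneral.
Variables (K : numFieldType).

(** The idempotent [p = b * a] equals both [a ^+ n * b ^+ n] and
[b ^+ n * a ^+ n] for [n > 0], while [p] fixes [a ^+ n] on both sides for
large [n]. Moving [c] across [a ^+ n] therefore gives [c * p = p * c * p] and
[p * c = p * c * p], so [c] commutes with [p]; then it commutes with
[b = b * p = p * b]. *)
Lemma drazin_eqs_bicommutant (B : banachAlgType K) (a b c : B) (m : nat) :
  drazin_eqs a b m -> GRing.comm a c -> GRing.comm b c.
Proof.
move=> [amb bab ab] ac.
pose p := b * a.
have pE : p = a * b by rewrite ab.
have bp : b * p = b by rewrite pE mulrA bab.
have pb : p * b = b by rewrite /p bab.
have pp : p * p = p by rewrite {2}/p mulrA pb.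
(* The exponent is m + 1 rather than m so that it is positive. *)
pose u := a ^+ m.+1; pose v := b ^+ m.+1.
have vu : v * u = p.
  rewrite /u /v -exprMn_comm; last exact: esym.
  by elim: (m) => [|n IHn]; rewrite ?expr1// exprS IHn.
have uv : u * v = p.
  by rewrite -vu; apply/commrX/commr_sym/commrX/commr_sym.
have up : u * p = u by rewrite /u exprS -mulrA /p [a ^+ m * _]mulrA amb.
have pu : p * u = u by rewrite -uv -mulrA vu.
have uc : u * c = c * u by apply/commr_sym/commrX/commr_sym.
have cp : c * p = p * (c * p).
  by rewrite -{1}uv mulrA -uc -{1}pu -[p * u * c]mulrA uc -!mulrA uv.
have pc : p * c = p * (c * p).
  by rewrite -{1}vu -mulrA uc -{1}up [c * (u * p)]mulrA -uc -mulrA mulrA vu.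
have pcp : p * c = c * p by rewrite cp.
rewrite /GRing.comm -{1}bp -mulrA pcp pE mulrA -mulrA.
by rewrite [c * (a * b)]mulrA -ac -mulrA mulrA -/p mulrA pcp -mulrA pb.
Qed.

Lemma drazin_invertible_eqs (B C : banachAlgType K) (a : B) (a' : C) :
  (forall m, (exists b, drazin_eqs a b m) <-> (exists b, drazin_eqs a' b m)) ->
  drazin_invertible a <-> drazin_invertible a'.
Proof.
move=> aa'; split=> -[b [m bm]].
- by have [|c cm] := (aa' m).1; [exists b | exists c, m].
- by have [|c cm] := (aa' m).2; [exists b | exists c, m].
Qed.

Lemma drazin_index_eqs (B C : banachAlgType K) (a : B) (a' : C) :
  (forall m, (exists b, drazin_eqs a b m) <-> (exists b, drazin_eqs a' b m)) ->
  drazin_index a = drazin_index a'.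
Proof.
move=> aa'.
have eqs m : `[< exists b, drazin_eqs a b m >] = `[< exists b, drazin_eqs a' b m >].
  exact: asbool_equiv_eq.
rewrite /drazin_index; case: pselect => [ex|nex]; case: pselect => [ex'|nex'] //.
- exact: eq_ex_minn.
- by case: nex'; case: ex => m; rewrite eqs; exists m.
- by case: nex; case: ex' => m; rewrite -eqs; exists m.
Qed.

End DrazinGeneral.

Section MultiplicationOperators.
Variables (R : realType) (A : banachAlgType R[i]).
Implicit Types (a b x : A) (T : bounded_op_alg A).

Lemma lmul1 : lmul (1 : A) = 1.
Proof. by apply: bounded_opP => x /=; rewrite mul1r. Qed.

Lemma rmul1 : rmul (1 : A) = 1.
Proof. by apply: bounded_opP => x /=; rewrite mulr1. Qed.

Lemma lmulM a b : lmul (a * b) = lmul a * lmul b.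
Proof. by apply: bounded_opP => x /=; rewrite mulrA. Qed.

Lemma rmulM a b : rmul (a * b) = rmul b * rmul a.
Proof. by apply: bounded_opP => x /=; rewrite mulrA. Qed.

Lemma lmulX a n : lmul (a ^+ n) = lmul a ^+ n.
Proof. by elim: n => [|n IHn]; rewrite ?expr0 ?lmul1// !exprS lmulM IHn. Qed.

Lemma rmulX a n : rmul (a ^+ n) = rmul a ^+ n.
Proof. by elim: n => [|n IHn]; rewrite ?expr0 ?rmul1// exprS exprSr rmulM IHn. Qed.

Lemma lmulB_scale a (l : R[i]) : lmul (a - l *: (1 : A)) =
  lmul a - l *: (1 : bounded_op_alg A).
Proof.
by apply: bounded_opP => x; rewrite /= mulrBl -banach_scalerAl mul1r.
Qed.

Lemma rmulB_scale a (l : R[i]) : rmul (a - l *: (1 : A)) =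
  rmul a - l *: (1 : bounded_op_alg A).
Proof.
by apply: bounded_opP => x; rewrite /= mulrBr -banach_scalerAr mulr1.
Qed.

Lemma lmul_inj : injective (@lmul R A).
Proof.
move=> a b /(congr1 (fun T : bounded_op A => T (1 : A))) /=.
by rewrite !mulr1.
Qed.

Lemma rmul_inj : injective (@rmul R A).
Proof.
move=> a b /(congr1 (fun T : bounded_op A => T (1 : A))) /=.
by rewrite !mul1r.
Qed.

Lemma lmul_rmul_comm a b : GRing.comm (lmul a) (rmul b).
Proof. by apply: bounded_opP => x /=; rewrite mulrA. Qed.

Lemma commutes_rmul T :
  (forall x, GRing.comm T (rmul x)) -> T = lmul ((T : bounded_op A) 1).
Proof.
move=> Tr; apply: bounded_opP => x.
have /(congr1 (fun S : bounded_op A => S (1 : A))) := Tr x.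
by rewrite /= mul1r.
Qed.

Lemma commutes_lmul T :
  (forall x, GRing.comm T (lmul x)) -> T = rmul ((T : bounded_op A) 1).
Proof.
move=> Tl; apply: bounded_opP => x.
have /(congr1 (fun S : bounded_op A => S (1 : A))) := Tl x.
by rewrite /= mulr1.
Qed.

Lemma drazin_eqs_lmul a b m : drazin_eqs (lmul a) (lmul b) m <-> drazin_eqs a b m.
Proof.
rewrite /drazin_eqs -lmulX -!lmulM.
split=> [[/lmul_inj e1 /lmul_inj e2 /lmul_inj e3]|[e1 e2 e3]]; first by [].
by split; congr lmul.
Qed.

(** Reversal turns [a ^+ m * b * a] into [a * b * a ^+ m]; the two agree because
[b * a = a * b] commutes with [a ^+ m]. *)
Lemma drazin_eqs_rmul a b m : drazin_eqs (rmul a) (rmul b) m <-> drazin_eqs a b m.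
Proof.
have rev : a * b = b * a -> a * (b * a ^+ m) = a ^+ m * b * a.
  move=> ab; rewrite mulrA -[RHS]mulrA -ab.
  have am : GRing.comm (a * b) (a ^+ m).
    by apply: commrX; rewrite /GRing.comm -mulrA -ab.
  exact: am.
rewrite /drazin_eqs -rmulX -!rmulM.
split=> [[/rmul_inj e1 /rmul_inj e2 /rmul_inj e3]|[e1 e2 e3]].
  by split; rewrite -?rev// -mulrA.
by split; congr rmul; rewrite // ?rev// mulrA.
Qed.

(** A Drazin inverse of [lmul a] is a left multiplication, because it commutes
with the right multiplications. *)
Lemma drazin_eqs_lmulP a m :
  (exists b, drazin_eqs a b m) <-> (exists T, drazin_eqs (lmul a) T m).
Proof.
split=> [[b ab]|[T aT]]; first by exists (lmul b); apply/drazin_eqs_lmul.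
have /commutes_rmul TE x : GRing.comm T (rmul x).
  exact: drazin_eqs_bicommutant aT (lmul_rmul_comm a x).
by rewrite TE in aT; exists ((T : bounded_op A) 1); apply/drazin_eqs_lmul.
Qed.

Lemma drazin_eqs_rmulP a m :
  (exists b, drazin_eqs a b m) <-> (exists T, drazin_eqs (rmul a) T m).
Proof.
split=> [[b ab]|[T aT]]; first by exists (rmul b); apply/drazin_eqs_rmul.
have /commutes_lmul TE x : GRing.comm T (lmul x).
  exact: drazin_eqs_bicommutant aT (commr_sym (lmul_rmul_comm x a)).
by rewrite TE in aT; exists ((T : bounded_op A) 1); apply/drazin_eqs_rmul.
Qed.

Lemma drazin_spectrum_lmul a : drazin_spectrum (lmul a) = drazin_spectrum a.
Proof.
apply/seteqP; split=> l; rewrite /drazin_spectrum /= -lmulB_scale;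
by rewrite -(drazin_invertible_eqs (drazin_eqs_lmulP _)).
Qed.

Lemma drazin_spectrum_rmul a : drazin_spectrum (rmul a) = drazin_spectrum a.
Proof.
apply/seteqP; split=> l; rewrite /drazin_spectrum /= -rmulB_scale;
by rewrite -(drazin_invertible_eqs (drazin_eqs_rmulP _)).
Qed.

End MultiplicationOperators.

Theorem theorem4 (R : realType) (A : banachAlgType R[i]) :
  (forall (a : A) (k : nat),
     [<-> drazin_invertible a /\ drazin_index a = k;
          drazin_invertible (lmul a) /\ drazin_index (lmul a) = k;
          drazin_invertible (rmul a) /\ drazin_index (rmul a) = k]
     /\ (drazin_invertible a /\ drazin_index a = k ->
         forall b : A, drazin_inverse a b ->
           drazin_inverse (lmul a) (lmul b) /\
           drazin_inverse (rmul a) (rmul b)))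
  /\ (forall a : A,
        drazin_spectrum a = drazin_spectrum (lmul a) /\
        drazin_spectrum (lmul a) = drazin_spectrum (rmul a)).
Proof.
split=> [a k|a]; last by rewrite drazin_spectrum_lmul drazin_spectrum_rmul.
split=> [|_ b [m ab]]; last first.
  by split; exists m; [apply/drazin_eqs_lmul | apply/drazin_eqs_rmul].
have il := drazin_invertible_eqs (drazin_eqs_lmulP a).
have ir := drazin_invertible_eqs (drazin_eqs_rmulP a).
rewrite -(drazin_index_eqs (drazin_eqs_lmulP a)).
rewrite -(drazin_index_eqs (drazin_eqs_rmulP a)).
tfae=> -[inv_a ind_a]; split=> //.
- exact/il.
- exact/ir/il.
- exact/ir.
Qed.
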